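(* Let $\mathcal{C}$ be a class of functions $\{0,1\}^n\to\mathbb{R}$. Assume there is an $\varepsilon>0$ such that for each $k=1,\ldots,4$ there is an $n^{O(1)}\cdot2^{n-\varepsilon n}$-time algorithm for the Sum-Product of $k$ functions $f_1(x_1,\ldots,x_n),\ldots,f_k(x_1,\ldots,x_n)$ from $\mathcal{C}$. Then there is a $2^{n-\varepsilon n}\cdot\mathrm{poly}(n,s)$-time algorithm that, given $f(x_1,\ldots,x_n)$ which is an arbitrary linear combination of $s$ functions from $\mathcal{C}$, determines whether or not $f(a)\in\{0,1\}$ for all $a\in\{0,1\}^n$.
   Context: The Sum-Product problem over $\mathcal{C}$: given $f_1,\ldots,f_k\in\mathcal{C}$ on Boolean variables $x_1,\ldots,x_n$, compute $\sum_{x\in\{0,1\}^n}\prod_{i=1}^kf_i(x)$ over $\mathbb{R}$. Members of $\mathcal{C}$ are given by representations (bit strings). *)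

(* Defs.v *)
From mathcomp Require Import all_boot all_order all_algebra.
From mathcomp Require Import all_classical all_reals all_analysis.

Set Implicit Arguments.
Unset Strict Implicit.
Unset Printing Implicit Defensive.

Import Order.TTheory GRing.Theory Num.Theory.
Local Open Scope ring_scope.

(** * Model of computation

    Sum-Product is computed exactly over the reals, on inputs that mix bit
    strings and real coefficients, so running times are those of a real
    machine: exact real arithmetic and comparisons at unit cost, next to
    discrete data.  The discrete part is the WHILE language of N. Jones
    (Computability and Complexity from a Programming Perspective): a finite
    program with finitely many variables, holding binary trees with shared
    subtrees.  Reals are extra leaves.  It simulates a real RAM with
    logarithmic overhead (memory as a balanced tree) and conversely with
    constant overhead, so bounds of the form poly * 2^(n - eps n) are the same
    in both.  The only constants are 0 and 1: no information can be hidden in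
    the reals of a program, and the syntax of programs does not depend on R. *)

Inductive expr : Type :=
| EVar of nat
| ENil
| ECons of expr & expr
| EHd of expr
| ETl of expr
| EZero
| EOne
| EAdd of expr & expr
| ESub of expr & expr
| EMul of expr & expr
| EDiv of expr & expr
| ELe of expr & expr.

Inductive prog : Type :=
| PAssign of nat & expr
| PSeq of prog & prog
| PIf of expr & prog & prog
| PWhile of expr & prog.

Inductive val (R : Type) : Type :=
| VNil
| VNum of R
| VCons of val R & val R.

Arguments VNil {R}.

Section Semantics.
Variable R : realType.
Implicit Types (v w : val R) (x y : R).

Definition vbool (b : bool) : val R := if b then VCons VNil VNil else VNil.

(* Operations are total: ill-typed ones return VNil, and x / 0 = 0. *)
Definition vhd v := if v is VCons a _ then a else VNil.
Definition vtl v := if v is VCons _ b then b else VNil.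
Definition varith (op : R -> R -> R) v w : val R :=
  match v, w with VNum x, VNum y => VNum (op x y) | _, _ => VNil end.
Definition vle v w : val R :=
  match v, w with VNum x, VNum y => vbool (x <= y) | _, _ => VNil end.
(* Conditionals and loops test for being different from VNil. *)
Definition vtrue v : bool := if v is VNil then false else true.

Definition store := nat -> val R.
Definition upd (s : store) (i : nat) v : store :=
  fun j => if j == i then v else s j.

Fixpoint eval (s : store) (e : expr) : val R :=
  match e with
  | EVar i => s i
  | ENil => VNil
  | ECons e1 e2 => VCons (eval s e1) (eval s e2)
  | EHd e1 => vhd (eval s e1)
  | ETl e1 => vtl (eval s e1)
  | EZero => VNum 0
  | EOne => VNum 1
  | EAdd e1 e2 => varith (fun x y => x + y) (eval s e1) (eval s e2)
  | ESub e1 e2 => varith (fun x y => x - y) (eval s e1) (eval s e2)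
  | EMul e1 e2 => varith (fun x y => x * y) (eval s e1) (eval s e2)
  | EDiv e1 e2 => varith (fun x y => x / y) (eval s e1) (eval s e2)
  | ELe e1 e2 => vle (eval s e1) (eval s e2)
  end.

Fixpoint ecost (e : expr) : nat :=
  match e with
  | EVar _ | ENil | EZero | EOne => 1%N
  | EHd e1 | ETl e1 => (ecost e1).+1
  | ECons e1 e2 | EAdd e1 e2 | ESub e1 e2 | EMul e1 e2 | EDiv e1 e2
  | ELe e1 e2 => (ecost e1 + ecost e2).+1%N
  end.

(* [exec p s s' t]: from store s, p halts in store s' after t steps. *)
Inductive exec : prog -> store -> store -> nat -> Prop :=
| exec_assign i e s :
    exec (PAssign i e) s (upd s i (eval s e)) (ecost e).+1
| exec_seq p q s s' s'' t t' :
    exec p s s' t -> exec q s' s'' t' -> exec (PSeq p q) s s'' (t + t')%N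
| exec_if e p q s s' t :
    exec (if vtrue (eval s e) then p else q) s s' t ->
    exec (PIf e p q) s s' ((ecost e).+1 + t)%N
| exec_while_stop e p s :
    ~~ vtrue (eval s e) -> exec (PWhile e p) s s (ecost e).+1
| exec_while_loop e p s s' s'' t t' :
    vtrue (eval s e) -> exec p s s' t -> exec (PWhile e p) s' s'' t' ->
    exec (PWhile e p) s s'' ((ecost e).+1 + t + t')%N.

(* Input and output are in variable 0; [exec] is deterministic. *)
Definition runs (p : prog) (input output : val R) (t : nat) : Prop :=
  exists2 s : store, exec p (upd (fun=> VNil) 0%N input) s t & s 0%N = output.

Definition vlist (l : seq (val R)) : val R := foldr (@VCons R) VNil l.
Definition vunary (n : nat) : val R := vlist (nseq n VNil).
Definition vbits (r : seq bool) : val R := vlist (map vbool r).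

End Semantics.

(** * Classes of functions, Sum-Product, linear combinations *)

Notation cube n := {ffun 'I_n -> bool}.

(* A class of functions {0,1}^n -> R, n ranging over nat, with its
   representation: [C n r] is the n-variable member represented by the bit
   string r, and None if r represents none.  A member may have several
   representations. *)
Definition func_class (R : realType) : Type :=
  forall n : nat, seq bool -> option (cube n -> R).

Section Problems.
Variables (R : realType) (C : func_class R).

Definition sum_product_input (n : nat) (rs : seq (seq bool)) : val R :=
  VCons (vunary R n) (vlist (map (@vbits R) rs)).

Definition sum_product_in_time (k : nat) (T : nat -> R) : Prop :=
  exists p : prog,
    forall (n : nat) (rs : k.-tuple (seq bool)) (f : 'I_k -> cube n -> R),
      (forall i, C n (tnth rs i) = Some (f i)) ->
      exists2 t : nat,
        runs p (sum_product_input n rs)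
          (VNum (\sum_(x : cube n) \prod_(i < k) f i x)) t
        & t%:R <= T n.

Definition lin_comb_input (n : nat) (l : seq (R * seq bool)) : val R :=
  VCons (vunary R n)
    (vlist [seq VCons (VNum cr.1) (vbits R cr.2) | cr <- l]).

(* Linear combinations have s >= 1 terms, with repetitions allowed. *)
Definition lin_comb_boolean_in_time (T : nat -> nat -> R) : Prop :=
  exists p : prog,
    forall (n s : nat) (a : 'I_s -> R) (rs : 'I_s -> seq bool)
           (g : 'I_s -> cube n -> R),
      (0 < s)%N ->
      (forall i, C n (rs i) = Some (g i)) ->
      let f := fun x : cube n => \sum_(i < s) a i * g i x in
      exists2 t : nat,
        runs p (lin_comb_input n [seq (a i, rs i) | i <- enum 'I_s])
          (vbool R [forall x : cube n, f x \in [:: 0; 1]]) t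
        & t%:R <= T n s.

End Problems.

(* Main.v *)
(** A real-valued [f] takes only the values 0 and 1 iff the nonnegative number
    [\sum_x f x ^ 2 * (f x - 1) ^ 2 = \sum_x (f x ^ 4 - 2 f x ^ 3 + f x ^ 2)]
    vanishes.  Expanding the powers of a linear combination of [s] functions
    turns it into at most [s^2 + s^3 + s^4] Sum-Products of 2, 3 or 4 functions.
    A tree walk of depth 4 over the list of terms enumerates them.
    Representations are passed on by reference and never read, so the time does
    not depend on their lengths; the constant-factor overhead is absorbed because
    a Sum-Product run takes at least one step, so that its time bound is at least 1
    (relevant when [eps > 1]). *)
Require Import Defs.
From mathcomp Require Import all_boot all_order all_algebra.
From mathcomp Require Import all_classical all_reals all_analysis.
From mathcomp Require Import zify ring.
Import Order.TTheory GRing.Theory Num.Theory.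
Local Open Scope ring_scope.

Set Implicit Arguments.
Unset Strict Implicit.
Unset Printing Implicit Defensive.

(** * Locality of execution and time-bounded total correctness *)

Fixpoint expr_bound (e : expr) : nat :=
  match e with
  | EVar i => i.+1
  | ENil | EZero | EOne => 0
  | EHd e1 | ETl e1 => expr_bound e1
  | ECons e1 e2 | EAdd e1 e2 | ESub e1 e2 | EMul e1 e2 | EDiv e1 e2
  | ELe e1 e2 => maxn (expr_bound e1) (expr_bound e2)
  end.

Fixpoint prog_bound (p : prog) : nat :=
  match p with
  | PAssign i e => maxn i.+1 (expr_bound e)
  | PSeq p q => maxn (prog_bound p) (prog_bound q)
  | PIf e p q => maxn (expr_bound e) (maxn (prog_bound p) (prog_bound q))
  | PWhile e p => maxn (expr_bound e) (prog_bound p)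
  end.

Section Execution.
Variable R : realType.
Implicit Types (s : store R) (p q : prog) (e : expr).

Lemma eval_agree m e s s1 : (expr_bound e <= m)%N ->
  (forall j, (j < m)%N -> s1 j = s j) -> Defs.eval s1 e = Defs.eval s e.
Proof.
move=> + agr; elim: e => //=.
all: try by move=> i /agr.
all: try by move=> e IH /IH ->.
all: by move=> e IHe f IHf; rewrite geq_max => /andP[/IHe -> /IHf ->].
Qed.

(** A program reads and writes only variables below its bound, so the run can be replayed, step for
    step, in any store with the same low part. This lets a given Sum-Product program run while the
    caller keeps its data at index [m] and above. *)
Lemma exec_frame m p s s' t : exec p s s' t -> (prog_bound p <= m)%N ->
  forall s1, (forall j, (j < m)%N -> s1 j = s j) ->
  exists s1', [/\ exec p s1 s1' t, forall j, (j < m)%N -> s1' j = s' j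
                & forall j, (m <= j)%N -> s1' j = s1 j].
Proof.
elim=> {p s s' t}.
- move=> i e s /=; rewrite geq_max => /andP[lim lem] s1 agr.
  exists (upd s1 i (Defs.eval s1 e)); split; first exact: exec_assign.
    by move=> j ltjm; rewrite /upd (eval_agree lem agr) agr.
  by move=> j lemj; rewrite /upd; case: eqP => // eji; lia.
- move=> p q s s' s'' t t' _ IHp _ IHq /=.
  rewrite geq_max => /andP[lep leq] s1 agr.
  have [s2 [ex2 agr2 out2]] := IHp lep s1 agr.
  have [s3 [ex3 agr3 out3]] := IHq leq s2 agr2.
  exists s3; split=> //; first exact: exec_seq ex2 ex3.
  by move=> j lemj; rewrite out3 ?out2.
- move=> e p q s s' t _ IH /=; rewrite !geq_max => /and3P[lee lep leq] s1 agr.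
  have [|s2 [ex2 agr2 out2]] := IH _ s1 agr; first by case: ifP.
  exists s2; split=> //; apply: exec_if.
  by rewrite (eval_agree lee agr).
- move=> e p s nt /=; rewrite geq_max => /andP[lee lep] s1 agr.
  by exists s1; split=> //; apply: exec_while_stop; rewrite (eval_agree lee agr).
- move=> e p s s' s'' t t' tt _ IHp _ IHw /=.
  rewrite geq_max => /andP[lee lep] s1 agr.
  have [s2 [ex2 agr2 out2]] := IHp lep s1 agr.
  have [|s3 [ex3 agr3 out3]] := IHw _ s2 agr2; first by rewrite /= geq_max lee.
  exists s3; split=> //.
    by apply: exec_while_loop ex2 ex3; rewrite (eval_agree lee agr).
  by move=> j lemj; rewrite out3 ?out2.
Qed.

Lemma exec_gt0 p s s' t : exec p s s' t -> (0 < t)%N.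
Proof. by elim=> // *; lia. Qed.

(** A total-correctness judgement with a step budget [B]; the lemmas below are its Hoare rules. *)
Definition halts_within (B : nat) p s (Q : store R -> Prop) : Prop :=
  exists s' t, [/\ exec p s s' t, (t <= B)%N & Q s'].

Lemma halts_assign B i e s (Q : store R -> Prop) :
  (ecost e < B)%N -> Q (upd s i (Defs.eval s e)) -> halts_within B (PAssign i e) s Q.
Proof.
by move=> ltB HQ; exists (upd s i (Defs.eval s e)), (ecost e).+1; split=> //; constructor.
Qed.

Lemma halts_seq B1 B2 B p q s (Q : store R -> Prop) : (B1 + B2 <= B)%N ->
  halts_within B1 p s (fun s' => halts_within B2 q s' Q) ->
  halts_within B (PSeq p q) s Q.
Proof.
move=> leB [s1 [t1 [ex1 le1 [s2 [t2 [ex2 le2 HQ]]]]]].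
exists s2, (t1 + t2)%N; split=> //; first exact: exec_seq ex1 ex2.
by apply: leq_trans leB; apply: leq_add.
Qed.

Lemma halts_conseq B B' p s (Q Q' : store R -> Prop) : (B' <= B)%N ->
  (forall s', Q' s' -> Q s') -> halts_within B' p s Q' -> halts_within B p s Q.
Proof.
move=> leB QQ' [s' [t [ex le HQ]]]; exists s', t; split=> //.
  exact: leq_trans leB.
exact: QQ'.
Qed.

(** The invariant is indexed by the items still in variable [i]. An encoded list is [VNil] exactly
    when empty, so the guard detects the end. Each test costs 2 steps, including the last, failing
    one. *)
Lemma halts_while_list (T : Type) (enc : T -> Defs.val R) B i p
    (Inv : seq T -> store R -> Prop) (l : seq T) s :
  (forall l' s', Inv l' s' -> s' i = vlist (map enc l')) ->
  (forall x l' s', Inv (x :: l') s' -> halts_within B p s' (Inv l')) ->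
  Inv l s ->
  halts_within (size l * (B + 2) + 2)%N (PWhile (EVar i) p) s (Inv [::]).
Proof.
move=> Hi Hp; elim: l s => [|x l IHl] s Hs.
  exists s, 2%N; split=> //; apply: (@exec_while_stop R (EVar i)).
  by rewrite /= (Hi _ _ Hs).
have [s1 [t1 [ex1 le1 Hs1]]] := Hp _ _ _ Hs.
have [s2 [t2 [ex2 le2 Hs2]]] := IHl _ Hs1.
exists s2, ((ecost (EVar i)).+1 + t1 + t2)%N; split=> //.
  by apply: exec_while_loop ex1 ex2; rewrite /= (Hi _ _ Hs).
by rewrite /= mulSn; lia.
Qed.

End Execution.

(** * Subroutine calls *)

Fixpoint reset (m : nat) : prog :=
  if m is m'.+1 then PSeq (PAssign m' ENil) (reset m') else PAssign 0 ENil.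

Definition call (m : nat) (p : prog) (e : expr) : prog :=
  PSeq (reset m) (PSeq (PAssign 0 e) p).

Section Call.
Variable R : realType.
Implicit Types (s : store R).

Lemma reset_halts m s : halts_within (2 * m + 2)%N (reset m) s
  (fun s' => forall j, s' j = if (j < m)%N || (j == 0)%N then VNil else s j).
Proof.
elim: m s => [|m IHm] s; first exact: halts_assign.
apply: (@halts_seq _ 2 (2 * m + 2)); first by lia.
apply: halts_assign => //=; apply: halts_conseq (IHm _) => // s' Hs' j.
rewrite Hs' /upd ltnS; case: (ltngtP j m) => //= _.
by case: eqP.
Qed.

(** [runs] starts from a store that is [VNil] outside variable 0, so leftovers of earlier calls are
    erased first. The argument [e] is evaluated after that erasure, hence its value may rest only on
    variables from [m] on. *)
Lemma call_halts m p e s v out t B : (0 < m)%N -> (prog_bound p <= m)%N ->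
  runs p v out t ->
  (forall s', (forall j, (m <= j)%N -> s' j = s j) -> Defs.eval s' e = v) ->
  (2 * m + ecost e + t + 3 <= B)%N ->
  halts_within B (call m p e) s
    (fun s' => s' 0%N = out /\ forall j, (m <= j)%N -> s' j = s j).
Proof.
move=> m0 lepm [sf ex out_sf] He leB.
apply: (@halts_seq _ (2 * m + 2) (ecost e + t + 1)); first by lia.
apply: halts_conseq (reset_halts m s) => // s1 Hs1.
have Hge j : (m <= j)%N -> s1 j = s j.
  by move=> lemj; rewrite Hs1 ltnNge lemj /=; case: eqP => //; lia.
apply: (@halts_seq _ (ecost e).+1 t); first by lia.
apply: halts_assign => //; rewrite (He _ Hge).
have [|s2 [ex2 agr2 out2]] :=
    exec_frame ex lepm (s1 := upd s1 0%N v).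
  by move=> j ltjm; rewrite /upd; case: eqP => // _; rewrite Hs1 ltjm.
exists s2, t; split=> //; split; first by rewrite agr2.
by move=> j lemj; rewrite out2 // /upd; case: eqP => [|_]; [lia|exact: Hge].
Qed.

End Call.

(** * The tree walk over tuples of terms *)

Ltac lookup :=
  rewrite /upd; repeat (case: eqP => ?; try (exfalso; lia)).

Section Walk.
Variables (m : nat) (ps : nat -> prog) (we : nat -> expr).

(* The variables below [m] belong to the subprograms [ps k].  At level [k] of
   the walk, [k] terms have been chosen: [vcoef k] holds the product of their
   coefficients, [vreps k] the list of their representations, and [viter k] the
   terms still to be tried as the next one. *)
Definition vterms := m.
Definition vdim := m.+1.
Definition vacc := m.+2.
Definition vcoef k := (m + 3 + 3 * k)%N.
Definition vreps k := (m + 4 + 3 * k)%N.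
Definition viter k := (m + 5 + 3 * k)%N.

Definition add_term k : prog :=
  PSeq (call m (ps k) (ECons (EVar vdim) (EVar (vreps k))))
       (PAssign vacc (EAdd (EVar vacc)
          (EMul (we k) (EMul (EVar (vcoef k)) (EVar 0))))).

(** Each child node adds its own product before its subtree is explored, so a single walk covers all
    degrees up to [d]. The assignment at depth 0 does nothing: it stands for a skip instruction. *)
Fixpoint walk (d k : nat) : prog :=
  if d is d'.+1 then
    PSeq (PAssign (viter k) (EVar vterms))
      (PWhile (EVar (viter k))
        (PSeq (PAssign (vcoef k.+1)
                 (EMul (EVar (vcoef k)) (EHd (EHd (EVar (viter k))))))
        (PSeq (PAssign (vreps k.+1)
                 (ECons (ETl (EHd (EVar (viter k)))) (EVar (vreps k))))
        (PSeq (PAssign (viter k) (ETl (EVar (viter k))))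
        (PSeq (add_term k.+1) (walk d' k.+1))))))
  else PAssign vacc (EVar vacc).

Definition decide d : prog :=
  PSeq (PAssign vterms (ETl (EVar 0)))
  (PSeq (PAssign vdim (EHd (EVar 0)))
  (PSeq (PAssign vacc EZero)
  (PSeq (PAssign (vcoef 0) EOne)
  (PSeq (PAssign (vreps 0) ENil)
  (PSeq (walk d 0)
        (PAssign 0 (ELe (EVar vacc) EZero))))))).

Variables (R : realType) (w : nat -> R).

(* Horner form of [\sum_(1 <= j < d.+1) w (k + j) * y ^+ j]. *)
Fixpoint walk_poly (d k : nat) (y : R) : R :=
  if d is d'.+1 then y * (w k.+1 + walk_poly d' k.+1 y) else 0.

Variables (n : nat) (F : seq bool -> cube n -> R) (valid : pred (seq bool)).
Variables (D N W : nat).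

Definition sum_prod (rs : seq (seq bool)) : R :=
  \sum_(x : cube n) \prod_(r <- rs) F r x.

Hypothesis m_gt0 : (0 < m)%N.
Hypothesis ps_bound : forall k, (0 < k <= D)%N -> (prog_bound (ps k) <= m)%N.
Hypothesis ps_runs : forall rs, (0 < size rs <= D)%N -> all valid rs ->
  exists2 t, runs (ps (size rs)) (sum_product_input R n rs)
                  (VNum (sum_prod rs)) t & (t <= N)%N.
Hypothesis weE : forall k (s : store R), Defs.eval s (we k) = VNum (w k).
Hypothesis we_cost : forall k, (ecost (we k) <= W)%N.

Definition term_val (e : R * seq bool) := VCons (VNum e.1) (vbits R e.2).

Definition lin_comb (l : seq (R * seq bool)) (x : cube n) : R :=
  \sum_(e <- l) e.1 * F e.2 x.

Definition at_level k (s : store R) l c a rs : Prop :=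
  [/\ s vterms = vlist (map term_val l), s vdim = vunary R n,
      s vacc = VNum c, s (vcoef k) = VNum a
    & s (vreps k) = vlist (map (@vbits R) rs)].

(** A walk at level [k] writes, apart from the scratch variables below [m] and the accumulator, only
    from [viter k] upwards; the data of the enclosing levels survive. *)
Definition preserved k (s s' : store R) : Prop :=
  forall j, (m <= j)%N -> (j < viter k)%N -> j != vacc -> s' j = s j.

Lemma add_term_halts s l c a rs :
  (0 < size rs <= D)%N -> all valid rs -> at_level (size rs) s l c a rs ->
  halts_within (2 * m + N + W + 20)%N (add_term (size rs)) s
    (fun s' => at_level (size rs) s' l (c + w (size rs) * (a * sum_prod rs)) a rs
       /\ forall j, (m <= j)%N -> j != vacc -> s' j = s j).
Proof.
move=> Hsz Hval [H1 H2 H3 H4 H5].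
have [t Hrun let_N] := ps_runs Hsz Hval.
apply: (@halts_seq _ (2 * m + N + 6) (W + 10)); first by lia.
have He s' : (forall j, (m <= j)%N -> s' j = s j) ->
    Defs.eval s' (ECons (EVar vdim) (EVar (vreps (size rs)))) = sum_product_input R n rs.
  by move=> agr /=; rewrite !agr ?H2 ?H5 // /vdim /vreps; lia.
apply: halts_conseq (call_halts m_gt0 (ps_bound Hsz) Hrun He (leqnn _)).
  by rewrite /=; lia.
move=> s1 [s10 agr].
apply: halts_assign; first by rewrite /= ; have := we_cost (size rs); lia.
have Hup j v : (m <= j)%N -> j != vacc -> upd s1 vacc v j = s j.
  by move=> lemj nj; rewrite /upd (negbTE nj) agr.
split; last by move=> j lemj nj; apply: Hup.
split; try by rewrite Hup // /vterms /vdim /vacc /vcoef /vreps; lia.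
by rewrite /upd eqxx /= weE s10 !agr ?H3 ?H4 //= /vacc /vcoef; lia.
Qed.

(** The factor [d.+1] is slack for the induction: each level contributes one more copy of the
    per-node cost times the power of [(size l).+1]. *)
Definition walk_time d (l : seq (R * seq bool)) :=
  (d.+1 * (2 * m + N + W + 50) * (size l).+1 ^ d)%N.

(** The Horner recursion mirrors the tree: expanding the outer factor [y = lin_comb l x] gives one
    summand per child, the weight [w k.+1] being the child's own term and the inner [walk_poly] its
    subtree. *)
Lemma walk_halts d s l c a rs :
  (size rs + d <= D)%N -> all valid rs -> all (fun e => valid e.2) l ->
  at_level (size rs) s l c a rs ->
  halts_within (walk_time d l) (walk d (size rs)) s
    (fun s' => preserved (size rs) s s' /\
       s' vacc = VNum (c + \sum_(x : cube n)
           a * (\prod_(r <- rs) F r x) * walk_poly d (size rs) (lin_comb l x))).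
Proof.
elim: d s c a rs => [|d IHd] s c a rs Hd Hrs Hl Hs.
  apply: halts_assign; first by rewrite /walk_time expn0 /=; lia.
  have [H1 H2 H3 H4 H5] := Hs; split.
    by move=> j _ _ nj; rewrite /upd (negbTE nj).
  rewrite /upd eqxx /= H3 big1 ?addr0 // => x _; exact: mulr0.
set k := size rs.
pose B := (2 * m + N + W + 50)%N.
(* The total contribution of the child that picks [e]: its own term plus its subtree. *)
pose E (e : R * seq bool) :=
  w k.+1 * (a * e.1 * sum_prod (e.2 :: rs)) + \sum_(x : cube n)
    a * e.1 * (\prod_(r <- e.2 :: rs) F r x) * walk_poly d k.+1 (lin_comb l x).
(* The conserved quantity is the accumulator plus the contributions of the children not yet
   tried. *)
pose Inv l' s' := [/\ preserved k s s', s' (viter k) = vlist (map term_val l'),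
  all (fun e => valid e.2) l' &
  exists2 c', s' vacc = VNum c' &
    c' + \sum_(e <- l') E e = c + \sum_(e <- l) E e].
have [H1 H2 H3 H4 H5] := Hs.
(* The sums over [l] and over the cube are exchanged; then the identity is the distributive law at
   each point. *)
have total : \sum_(e <- l) E e = \sum_(x : cube n)
    a * (\prod_(r <- rs) F r x) * walk_poly d.+1 k (lin_comb l x).
  rewrite big_split /= -mulr_sumr.
  under [in X in w _ * X]eq_bigr => e _ do rewrite /sum_prod mulr_sumr.
  rewrite exchange_big /= mulr_sumr [X in _ + X]exchange_big /= -big_split /=.
  apply: eq_bigr => x _.
  rewrite [in RHS]/lin_comb mulr_suml mulr_sumr mulr_sumr -big_split /=.
  apply: eq_bigr => e _; rewrite big_cons /lin_comb; ring.
rewrite -/(walk_poly d.+1 k) -total.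
(* The loop body: 6 + 6 + 3 steps for the three assignments, [B - 19] for [add_term], then the
   recursive walk. *)
pose Bw := (B - 4 + walk_time d l)%N.
have time_ok : (2 + (size l * (Bw + 2) + 2) <= walk_time d.+1 l)%N.
  rewrite /Bw /walk_time -/B expnS.
  set X := ((size l).+1 ^ d)%N.
  have X0 : (0 < X)%N by rewrite expn_gt0.
  have B50 : (50 <= B)%N by rewrite /B; lia.
  nia.
apply: (halts_seq time_ok).
apply: halts_assign => //=.
apply: halts_conseq (halts_while_list (enc := term_val) (Inv := Inv)
    (B := Bw) (l := l) _ _ _) => //.
- move=> s' [pres _ _ [c' Hc']]; rewrite big_nil addr0 => ec'.
  by split=> //; rewrite Hc' ec'.
- by move=> l' s' [].
- move=> [b r] l' s1 [pres Hit /= /andP[vr vl'] [c' Hc' ec']].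
  have p1 j : (m <= j)%N -> (j < viter k)%N -> j != vacc -> s1 j = s j by exact: pres.
  have [q1 q2 q3 q4] : [/\ s1 vterms = s vterms, s1 vdim = s vdim,
      s1 (vcoef k) = s (vcoef k) & s1 (vreps k) = s (vreps k)].
    by split; apply: p1; rewrite /vterms /vdim /vacc /vcoef /vreps /viter; lia.
  have lt0 : (0 < walk_time d l)%N.
    by rewrite /walk_time !muln_gt0 expn_gt0 /=; lia.
  apply: (@halts_seq _ 6 (B - 10 + walk_time d l)); first by rewrite /Bw /B; lia.
  apply: halts_assign => //=; rewrite q3 H4 Hit /=.
  apply: (@halts_seq _ 6 (B - 16 + walk_time d l)); first by rewrite /B; lia.
  apply: halts_assign => //=.
  apply: (@halts_seq _ 3 (B - 19 + walk_time d l)); first by rewrite /B; lia.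
  apply: halts_assign => //=.
  apply: (@halts_seq _ (B - 19) (walk_time d l)) => //.
  set s4 := upd _ (viter k) _.
  have s4E j : (m <= j)%N -> (j <= vacc)%N || (j < viter k)%N -> s4 j = s1 j.
    move=> lemj ltj.
    by move: ltj; rewrite /s4 /vacc /viter /vcoef /vreps => ltj; lookup.
  have L4 : at_level (size (r :: rs)) s4 l c' (a * b) (r :: rs).
    split.
    - by rewrite s4E ?q1 /vterms /vacc //; lia.
    - by rewrite s4E ?q2 /vdim /vacc //; lia.
    - by rewrite s4E ?leqnn // /vacc; lia.
    - by rewrite /s4 /vcoef /viter /vreps /=; lookup.
    - rewrite /s4 /vcoef /viter /vreps /=; lookup.
      by rewrite /= -/(viter k) -/(vreps k) Hit q4 H5.
  have vrs : all valid (r :: rs) by rewrite /= vr.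
  have Hd1 : (0 < size (r :: rs) <= D)%N by rewrite /=; lia.
  apply: halts_conseq (add_term_halts Hd1 vrs L4); first by rewrite /B; lia.
  move=> s5 [L5 pres5].
  have Hd2 : (size (r :: rs) + d <= D)%N by rewrite /=; lia.
  apply: halts_conseq (IHd _ _ _ _ Hd2 vrs Hl L5) => // s6 [pres6 acc6].
  (* The recursive call preserves everything below [viter k.+1], in particular the iterator of the
     present level. *)
  have fin j : (m <= j)%N -> (j <= viter k)%N -> j != vacc -> s6 j = s4 j.
    move=> lemj ltj nj; rewrite pres6 ?pres5 //.
    by move: ltj; rewrite /viter /=; lia.
  split=> //.
  + move=> j lemj ltj nj; rewrite fin ?s4E ?ltj ?orbT //; first exact: p1.
    exact: ltnW.
  + rewrite fin ?leqnn //; try by rewrite /viter /vacc; lia.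
    by rewrite /s4 /viter /vcoef /vreps; lookup; rewrite /= -/(viter k) Hit.
  + eexists; first exact: acc6.
    by rewrite -ec' big_cons {2}/E /= !addrA.
- split=> //.
  + by move=> j _ ltj _; rewrite /upd ltn_eqF.
  + by rewrite /upd eqxx H1.
  + by exists c => //; rewrite /upd /vacc /viter; case: eqP => [|_] //; lia.
Qed.

(** The language compares only by [ELe], so the test is [<= 0]; for a nonnegative sum this means
    vanishing. *)
Lemma decide_runs d l : (d <= D)%N -> all (fun e => valid e.2) l ->
  exists2 t, runs (decide d) (lin_comb_input n l)
      (vbool R (\sum_(x : cube n) walk_poly d 0 (lin_comb l x) <= 0)) t
    & (t <= walk_time d l + 20)%N.
Proof.
move=> leD Hl.
pose s0 := upd (fun=> VNil) 0%N (lin_comb_input n l).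
suff [s [t [ex let_ out]]] : halts_within (walk_time d l + 20) (decide d) s0
    (fun s => s 0%N =
      vbool R (\sum_(x : cube n) walk_poly d 0 (lin_comb l x) <= 0)).
  by exists t => //; exists s.
apply: (@halts_seq _ 3 (walk_time d l + 17)); first by lia.
apply: halts_assign => //=.
apply: (@halts_seq _ 3 (walk_time d l + 14)); first by lia.
apply: halts_assign => //=.
apply: (@halts_seq _ 2 (walk_time d l + 12)); first by lia.
apply: halts_assign => //=.
apply: (@halts_seq _ 2 (walk_time d l + 10)); first by lia.
apply: halts_assign => //=.
apply: (@halts_seq _ 2 (walk_time d l + 8)); first by lia.
apply: halts_assign => //=.
apply: (@halts_seq _ (walk_time d l) 8); first by lia.
set s1 := upd _ (vreps 0) _.
have L1 : at_level (size (Nil (seq bool))) s1 l 0 1 [::].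
  by split; rewrite /s1 /vterms /vdim /vacc /vcoef /vreps; lookup.
apply: halts_conseq (walk_halts (rs := [::]) leD _ Hl L1) => // s2 [_ acc2].
apply: halts_assign => //=.
rewrite /upd eqxx acc2 /= add0r; congr (vbool R (_ <= 0)).
by apply: eq_bigr => x _; rewrite big_nil !mul1r.
Qed.

End Walk.

(** * The test polynomial and the final time bound *)

Definition weight_expr (k : nat) : expr :=
  if (k == 2) || (k == 4) then EOne
  else if k == 3 then ESub EZero (EAdd EOne EOne) else EZero.

(** The coefficients of [y^4 - 2 y^3 + y^2], with -2 spelled as [0 - (1 + 1)] to agree with the
    evaluation of [weight_expr] by computation. *)
Definition weight (R : realType) (k : nat) : R :=
  if (k == 2)%N || (k == 4)%N then 1 else if k == 3 then 0 - (1 + 1) else 0.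

Lemma weight_exprE (R : realType) k (s : store R) :
  Defs.eval s (weight_expr k) = VNum (weight R k).
Proof. by rewrite /weight_expr /weight; do 2 case: ifP => _ //. Qed.

Lemma weight_expr_cost k : (ecost (weight_expr k) <= 5)%N.
Proof. by rewrite /weight_expr; do 2 case: ifP => _ //. Qed.

Lemma walk_poly_weight (R : realType) (y : R) :
  walk_poly (weight R) 4 0 y = (y * (y - 1)) ^+ 2.
Proof. by rewrite /= /weight /=; ring. Qed.

Lemma sum_sqr_le0 (R : realType) (n : nat) (f : cube n -> R) :
  (\sum_x (f x * (f x - 1)) ^+ 2 <= 0) = [forall x, f x \in [:: 0; 1]].
Proof.
have -> : (\sum_x (f x * (f x - 1)) ^+ 2 <= 0) =
          (\sum_x (f x * (f x - 1)) ^+ 2 == 0).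
  by rewrite eq_le sumr_ge0 ?andbT // => x _; exact: sqr_ge0.
rewrite psumr_eq0; last by move=> x _; exact: sqr_ge0.
apply/allP/forallP => H x.
  by have := H x (mem_index_enum x); rewrite /= sqrf_eq0 mulf_eq0 subr_eq0 !inE.
by move=> _; rewrite /= sqrf_eq0 mulf_eq0 subr_eq0; have := H x; rewrite !inE.
Qed.

Theorem theorem3p1 (R : realType) (C : func_class R) (eps : R)
  (heps : 0 < eps)
  (hSP : forall k : nat, (1 <= k <= 4)%N ->
     exists c : nat, sum_product_in_time C k
       (fun n => c%:R * n.+1%:R ^+ c * 2 `^ (n%:R - eps * n%:R))) :
  exists c : nat, lin_comb_boolean_in_time C
    (fun n s => 2 `^ (n%:R - eps * n%:R) * (c%:R * (n + s).+1%:R ^+ c)).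
Proof.
pose solves k (cp : nat * prog) := (1 <= k <= 4)%N ->
  forall (n : nat) (rs : k.-tuple (seq bool)) (f : 'I_k -> cube n -> R),
    (forall i, C n (tnth rs i) = Some (f i)) ->
    exists2 t : nat,
      runs cp.2 (sum_product_input R n rs)
        (VNum (\sum_(x : cube n) \prod_(i < k) f i x)) t
      & t%:R <= cp.1%:R * n.+1%:R ^+ cp.1 * 2 `^ (n%:R - eps * n%:R).
have [k|cp Hcp] := @boolp.choice _ _ solves.
  have [Hk|nHk] := boolP (1 <= k <= 4)%N.
    by have [c [p Hp]] := hSP k Hk; exists (c, p) => _; exact: Hp.
  by exists (0%N, PAssign 0 ENil) => Hk; rewrite Hk in nHk.
(* Sums serve as common upper bounds for the four constants and the four program bounds. *)
pose M := (\sum_(k < 5) (cp k).1)%N.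
pose m := (\sum_(k < 5) prog_bound (cp k).2).+1%N.
have leM k : (1 <= k <= 4)%N -> ((cp k).1 <= M)%N.
  move=> Hk; have k5 : (k < 5)%N by lia.
  by rewrite /M (bigD1 (Ordinal k5)) //= leq_addr.
have lem k : (0 < k <= 4)%N -> (prog_bound (cp k).2 <= m)%N.
  move=> Hk; have k5 : (k < 5)%N by lia.
  by apply: leqW; rewrite (bigD1 (Ordinal k5)) //= leq_addr.
pose K := (10 * (2 * m + 80))%N.
exists (K * M + M + 4)%N; exists (decide m (fun k => (cp k).2) weight_expr 4).
move=> n s a rs g s0 Hg f.
pose F r := odflt (fun=> 0) (C n r).
pose T : R := M%:R * n.+1%:R ^+ M * 2 `^ (n%:R - eps * n%:R).
(* A step count is at most the real bound [T] iff it is at most its truncation, which moves the time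
   analysis to [nat]. *)
pose N := Num.truncn T.
have P0 : 0 <= 2 `^ (n%:R - eps * n%:R) :> R by exact: powR_ge0.
have T0 : 0 <= T by rewrite !mulr_ge0 // ?exprn_ge0.
have Hruns (l : seq (seq bool)) : (0 < size l <= 4)%N -> all (fun r => C n r) l ->
    exists2 t, runs (cp (size l)).2 (sum_product_input R n l)
                  (VNum (sum_prod F l)) t & (t <= N)%N.
  move=> Hl /allP Hv.
  have [|t Ht leT] := Hcp _ Hl n (in_tuple l) (fun i => F (tnth (in_tuple l) i)).
    move=> i; have := Hv _ (mem_tnth i (in_tuple l)).
    by rewrite /F; case: (C n _).
  exists t.
    rewrite /sum_prod; under eq_bigr => x _ do rewrite big_tnth.
    exact: Ht.
  rewrite truncn_ge_nat //; apply: le_trans leT _.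
  rewrite ler_wpM2r // ler_pM ?exprn_ge0 ?ler_nat ?leM //.
  by rewrite ler_weXn2l ?leM // ler1n.
pose l := [seq (a i, rs i) | i <- enum 'I_s].
have Hl : all (fun e => C n e.2) l.
  by apply/allP => _ /mapP[i _ ->] /=; rewrite Hg.
have fE x : lin_comb F l x = f x.
  rewrite /lin_comb big_map big_enum /=; apply: eq_bigr => i _.
  by rewrite /F Hg.
(* Since [s > 0], there is a valid one-function input, and its run takes at least one step. *)
have N1 : (1 <= N)%N.
  have [|/= |t [st ex _]] := Hruns [:: rs (Ordinal s0)] => //.
    by rewrite Hg.
  by apply: leq_trans; exact: exec_gt0 ex.
have [t Ht let_] := decide_runs (isT : (0 < m)%N) lem Hruns
    (@weight_exprE R) weight_expr_cost (leqnn 4) Hl.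
exists t.
  rewrite -sum_sqr_le0; move: Ht; rewrite /l.
  by under eq_bigr => x _ do rewrite walk_poly_weight fE.
have szl : size l = s by rewrite size_map size_enum_ord.
(* [N1] turns the additive overhead of each call into a multiple of [N]. *)
have t_le : (t <= K * (s.+1 ^ 4 * N))%N.
  apply: leq_trans let_ _; rewrite /walk_time szl /K.
  set X := (s.+1 ^ 4)%N; have X0 : (0 < X)%N by rewrite expn_gt0.
  nia.
have N_le : N%:R <= T by rewrite truncn_le.
apply: (@le_trans _ _ ((K * s.+1 ^ 4)%:R * T)).
  apply: (@le_trans _ _ (K * (s.+1 ^ 4 * N))%:R); first by rewrite ler_nat.
  by rewrite mulnA natrM ler_wpM2l.
rewrite /T mulrA mulrC ler_wpM2l // -!natrX -!natrM ler_nat.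
set c := (K * M + M + 4)%N.
(* Both bases are raised to [(n + s).+1]; [c] dominates the coefficient [K * M] as well as the
   exponent [4 + M]. *)
apply: (@leq_trans ((K * M) * ((n + s).+1 ^ 4 * (n + s).+1 ^ M)))%N.
  have mono e u v : (u <= v -> u ^ e <= v ^ e)%N.
    by move=> leuv; case: e => // e; rewrite leq_exp2r.
  rewrite mulnACA leq_mul2l; apply/orP; right.
  by apply: leq_mul; apply: mono; rewrite ltnS ?leq_addl ?leq_addr.
rewrite -expnD leq_mul //; first by rewrite /c; lia.
by apply: leq_pexp2l => //; rewrite /c; lia.
Qed.
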